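(* Let $N\ge1$ be an integer, let $S_0>0$ and $u>r>d>0$ be real numbers, and consider the $N$-round Cox-Ross-Rubinstein game with these parameters. Let $\eta$ be any real-valued function on the set $\{u^md^{N-m}S_0 : m=0,\dots,N\}$ of possible values of $S_N$. Then the upper and lower expected values of $\eta(S_N)$ coincide and are given by $$\overline{\mathbb E}(\eta(S_N))=\underline{\mathbb E}(\eta(S_N))=\frac1{r^N}\sum_{m=0}^N\binom Nm p^m(1-p)^{N-m}\,\eta(u^md^{N-m}S_0),\qquad p=\frac{r-d}{u-d}.$$
   Context: Cox-Ross-Rubinstein game: $S_0>0$, $u>r>d>0$ and an initial capital $\mathcal K_0\in\mathbb R$ are given. In each round $n=1,\dots,N$, Skeptic announces $M_n\in\mathbb R$, then Reality announces $x_n\in\{u,d\}$; then $S_n=S_{n-1}x_n$ and Skeptic's capital is updated by $$\mathcal K_n=\mathcal K_{n-1}+M_n(S_n-S_{n-1})+(r-1)(\mathcal K_{n-1}-M_nS_{n-1}).$$ A path is a sequence $\xi=x_1\dots x_N$ of Reality's moves. A strategy $\mathcal P$ of Skeptic specifies each $M_n$ as a function of Reality's previous moves $x_1,\dots,x_{n-1}$. For $\alpha\in\mathbb R$, let $\mathcal K^{\mathcal P,\alpha}_N(\xi)$ denote Skeptic's final capital along $\xi$ when he uses $\mathcal P$ with initial capital $\mathcal K_0=\alpha$. For a random variable, i.e. a real-valued function $x(\xi)$ of the path, the upper and lower expected values (prices at time $0$) are $$\overline{\mathbb E}x=\inf\{\alpha\in\mathbb R \mid \exists\mathcal P\ \forall\xi:\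 \mathcal K^{\mathcal P,\alpha}_N(\xi)\ge x(\xi)\},$$ $$\underline{\mathbb E}x=\sup\{\alpha\in\mathbb R \mid \exists\mathcal P\ \forall\xi:\ \mathcal K^{\mathcal P,\alpha}_N(\xi)\le x(\xi)\}.$$ *)

(* Defs.v *)
From HB Require Import structures.
From mathcomp Require Import all_boot all_order all_algebra.
From mathcomp Require Import boolp classical_sets reals ereal.

Set Implicit Arguments.
Unset Strict Implicit.
Unset Printing Implicit Defensive.

Import Order.TTheory GRing.Theory Num.Theory.
Local Open Scope classical_set_scope.
Local Open Scope ring_scope.

(* The Cox-Ross-Rubinstein game with interest factor [r] and up/down factors
   [u], [d].  Reality's move is encoded as a boolean: [true] stands for [u] and
   [false] for [d]. *)
Definition game_path (N : nat) : Type := N.-tuple bool.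

Definition random_variable (R : realType) (N : nat) : Type := game_path N -> R.

(* Skeptic's move in a round, as a function of Reality's previous moves
   (listed in chronological order). *)
Definition strategy (R : realType) : Type := seq bool -> R.

Section Game.
Variables (R : realType) (S0 u d r : R).

Definition factor (x : bool) : R := if x then u else d.

(* [nth false xi k] is the move x_(k+1), so that [price xi n] is S_n;
   the default value of [nth] is never used for n <= size xi. *)
Fixpoint price (xi : seq bool) (n : nat) : R :=
  if n is k.+1 then price xi k * factor (nth false xi k) else S0.

Fixpoint capital (P : strategy R) (alpha : R) (xi : seq bool) (n : nat) : R :=
  if n is k.+1 then
    let K := capital P alpha xi k in
    let M := P (take k xi) in
    K + M * (price xi k.+1 - price xi k) + (r - 1) * (K - M * price xi k)
  else alpha.

(* The infimum and supremum are taken in the extended reals, so that an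
   equality with a real number also asserts that they are finite. *)
Definition upper_expectation (N : nat) (x : random_variable R N) : \bar R :=
  ereal_inf [set alpha%:E | alpha in
    [set alpha : R | exists P : strategy R,
       forall xi : game_path N, x xi <= capital P alpha xi N]].

Definition lower_expectation (N : nat) (x : random_variable R N) : \bar R :=
  ereal_sup [set alpha%:E | alpha in
    [set alpha : R | exists P : strategy R,
       forall xi : game_path N, capital P alpha xi N <= x xi]].

End Game.

(* Main.v *)
Require Import Defs.
From mathcomp Require Import all_boot all_order all_algebra.
From mathcomp Require Import boolp classical_sets reals ereal.
From mathcomp Require Import ring lra.

Import Order.TTheory GRing.Theory Num.Theory.
Local Open Scope ring_scope.

(** The discounted binomial average of eta satisfies, by Pascal's rule, the
backward recursion r V_(n+1)(s) = p V_n(su) + (1-p) V_n(sd).  Since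
pu + (1-p)d = r, delta hedging with V started from V_N(S0) replicates
eta(S_N) exactly on every path.  Conversely, capital is jointly linear in the
strategy and the initial capital, and from negative capital Reality can always
keep it negative by choosing u or d against the sign of Skeptic's position;
so if one strategy ends no higher than another on every path, it also starts
no higher.  Hence the replication cost is both prices. *)

(** [f] takes the numbers of up and down moves separately, so one extra move just increments one
    argument. *)
Lemma sum_bin_pascal (R : pzRingType) (f : nat -> nat -> R) (n : nat) :
  \sum_(m < n.+2) 'C(n.+1, m)%:R * f m (n.+1 - m)%N =
  \sum_(m < n.+1) 'C(n, m)%:R * (f m.+1 (n - m)%N + f m (n - m).+1).
Proof.
under [RHS]eq_bigr do rewrite mulrDr.
rewrite big_split /= big_ord_recl /= bin0 subn0.
under eq_bigr do rewrite /bump /= add1n binS natrD mulrDl subSS.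
rewrite big_split /= addrA addrC; congr (_ + _).
(* The top term vanishes, since ['C(n, n.+1)] is zero. *)
rewrite big_ord_recr /= bin_small // mul0r addr0.
rewrite [RHS]big_ord_recl /= bin0 subn0; congr (_ + _).
by apply: eq_bigr => i _; rewrite /bump /= add1n subnSK.
Qed.

Section CoxRossRubinstein.
Variables (R : realType) (S0 u d r : R).
Implicit Types (P Q : strategy R) (a b : R) (xi : seq bool) (n : nat).

Local Notation price := (price S0 u d).
Local Notation capital := (capital S0 u d r).

Lemma price_cat xi (ys : seq bool) n :
  (n <= size xi)%N -> price (xi ++ ys) n = price xi n.
Proof. by elim: n => //= n IH hn; rewrite IH ?(ltnW hn)// nth_cat hn. Qed.

Lemma capital_cat P a xi (ys : seq bool) n :
  (n <= size xi)%N -> capital P a (xi ++ ys) n = capital P a xi n.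
Proof.
elim: n => //= n IH hn.
by rewrite IH ?price_cat ?takel_cat ?nth_cat ?hn// ltnW.
Qed.

(** Strategies see only [take n xi]; this lets a hedge computed from that prefix use the true
    current price. *)
Lemma price_take xi n : (n <= size xi)%N -> price (take n xi) n = price xi n.
Proof.
by move=> hn; rewrite -{2}(cat_take_drop n xi) price_cat ?size_takel.
Qed.

Lemma capitalB P Q a b xi n :
  capital (fun l => P l - Q l) (a - b) xi n =
  capital P a xi n - capital Q b xi n.
Proof. by elim: n => //= n ->; ring. Qed.

Lemma price_gt0 xi n : 0 < S0 -> 0 < u -> 0 < d -> 0 < price xi n.
Proof.
move=> hS0 hu hd; elim: n => //= n IH.
by rewrite mulr_gt0 // /factor; case: ifP.
Qed.

Section NoArbitrage.
Hypotheses (hS0 : 0 < S0) (hur : r < u) (hrd : d < r) (hd : 0 < d).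

Let hr : 0 < r := lt_trans hd hrd.
Let hu : 0 < u := lt_trans hr hur.

Lemma capital_lt0 P a n :
  a < 0 -> exists xi : game_path n, capital P a xi n < 0.
Proof.
move=> ha; elim: n => [|n [xi hxi]]; first by exists [tuple].
(* Reality moves up when Skeptic is short or flat, and down when he is long. *)
exists (rcons_tuple xi (P xi <= 0)).
have hsz : (n <= size xi)%N by rewrite size_tuple.
rewrite /= -cats1 capital_cat // price_cat // takel_cat //.
rewrite take_oversize ?size_tuple // nth_cat size_tuple ltnn subnn /=.
have hS : 0 < price xi n by exact: price_gt0.
set K := capital _ _ _ _ in hxi *; set S := Defs.price _ _ _ _ _ in hS *.
set M := P xi; set x := factor _ _ _.
(* Riskless growth of the whole capital plus the excess return on the position; the chosen move
   makes the latter nonpositive. *)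
rewrite (_ : _ + _ = r * K + S * (M * (x - r))); last by ring.
have hrK : r * K < 0 by rewrite pmulr_rlt0.
suff : S * (M * (x - r)) <= 0 by lra.
rewrite pmulr_rle0 // /x /factor; case: (ltrP 0 M) => hM.
- by rewrite pmulr_rle0 // subr_le0 ltW.
- by rewrite mulr_le0_ge0 // subr_ge0 ltW.
Qed.

Lemma capital_le_initial P Q a b n :
  (forall xi : game_path n, capital P a xi n <= capital Q b xi n) -> a <= b.
Proof.
move=> hPQ; rewrite leNgt -subr_lt0; apply/negP.
move=> /(capital_lt0 (fun l => Q l - P l) (b - a) n)[xi].
by rewrite capitalB subr_lt0 ltNge hPQ.
Qed.

Lemma upper_expectation_replicable n (x : random_variable R n) Q b :
  (forall xi : game_path n, capital Q b xi n = x xi) ->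
  upper_expectation S0 u d r x = b%:E.
Proof.
move=> hQ; apply/eqP; rewrite eq_le; apply/andP; split.
- by apply: ereal_inf_lbound; exists b => //; exists Q => xi; rewrite hQ.
(* Any superhedge ends at or above the replicating [Q], hence starts at or above [b]. *)
- apply: le_ereal_inf_tmp => _ [a [P hP] <-]; rewrite lee_fin.
  by apply: (capital_le_initial Q P b a n) => xi; rewrite hQ.
Qed.

Lemma lower_expectation_replicable n (x : random_variable R n) Q b :
  (forall xi : game_path n, capital Q b xi n = x xi) ->
  lower_expectation S0 u d r x = b%:E.
Proof.
move=> hQ; apply/eqP; rewrite eq_le; apply/andP; split.
- apply: ge_ereal_sup => _ [a [P hP] <-]; rewrite lee_fin.
  by apply: (capital_le_initial P Q a b n) => xi; rewrite hQ.
- by apply: ereal_sup_ubound; exists b => //; exists Q => xi; rewrite hQ.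
Qed.

End NoArbitrage.

Variable eta : R -> R.

Let p := (r - d) / (u - d).

(** Here [n] counts the rounds still to be played and [s] is the current price. *)
Definition binomial_value n (s : R) : R :=
  (r ^+ n)^-1 *
    \sum_(m < n.+1) 'C(n, m)%:R * p ^+ m * (1 - p) ^+ (n - m)
                    * eta (u ^+ m * d ^+ (n - m) * s).

Lemma binomial_value0 s : binomial_value 0 s = eta s.
Proof.
by rewrite /binomial_value big_ord1 !expr0 bin0 invr1 !mul1r.
Qed.

Lemma binomial_valueS n s : r != 0 ->
  r * binomial_value n.+1 s =
  p * binomial_value n (s * u) + (1 - p) * binomial_value n (s * d).
Proof.
move=> hr; rewrite /binomial_value; move: p => q.
rewrite exprS invfM !mulrA divff // mul1r.
rewrite ![_ * (r ^+ n)^-1]mulrC -!mulrA -mulrDr; congr (_ * _).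
pose f i j := q ^+ i * (1 - q) ^+ j * eta (u ^+ i * d ^+ j * s).
transitivity (\sum_(m < n.+2) 'C(n.+1, m)%:R * f m (n.+1 - m)%N).
  by apply: eq_bigr => i _; rewrite /f !mulrA.
rewrite sum_bin_pascal !mulr_sumr -big_split /=.
apply: eq_bigr => i _; rewrite /f !exprS.
(* The extra factor [u] or [d] is absorbed into the starting price, as a first move. *)
rewrite [X in eta X](_ : _ = u ^+ i * d ^+ (n - i) * (s * u)); last by ring.
rewrite [X in _ + _ * eta X](_ : _ = u ^+ i * d ^+ (n - i) * (s * d));
  last by ring.
by ring.
Qed.

(** The ratio of the spread in next-round value to the spread in next-round price; [k] rounds remain
    after the coming move. *)
Definition delta_hedge n : strategy R := fun l =>
  let s := price l (size l) in
  let k := (n - (size l).+1)%N in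
  (binomial_value k (s * u) - binomial_value k (s * d)) / (s * (u - d)).

Hypotheses (hS0 : 0 < S0) (hur : r < u) (hrd : d < r) (hd : 0 < d).

Let hr : 0 < r := lt_trans hd hrd.
Let hu : 0 < u := lt_trans hr hur.

Lemma capital_delta_hedge n xi k : size xi = n -> (k <= n)%N ->
  capital (delta_hedge n) (binomial_value n S0) xi k =
  binomial_value (n - k) (price xi k).
Proof.
move=> hsz; elim: k => [|k IH] hk /=; first by rewrite subn0.
have hkxi : (k <= size xi)%N by rewrite hsz ltnW.
rewrite IH ?(ltnW hk) // /delta_hedge size_takel // price_take //.
have hS : price xi k != 0 by rewrite gt_eqF // price_gt0.
have hud : u - d != 0 by rewrite gt_eqF // subr_gt0 (lt_trans hrd).
have r_neq0 : r != 0 by rewrite gt_eqF.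
have := binomial_valueS (n - k.+1) (price xi k) r_neq0.
rewrite subnSK // => /(canRL (mulKf r_neq0)) ->.
(* The value of [p] enters here: [p + (u - r) / (u - d) = 1] settles the up move, and
   [p = (r - d) / (u - d)] cancels the hedge term in the down move. *)
rewrite /factor /p; case: (nth _ _ _); field; exact/and3P.
Qed.

Lemma delta_hedge_replicates n (xi : game_path n) :
  capital (delta_hedge n) (binomial_value n S0) xi n = eta (price xi n).
Proof.
by rewrite capital_delta_hedge ?size_tuple // subnn binomial_value0.
Qed.

End CoxRossRubinstein.

Theorem theorem3p1 (R : realType) (N : nat) (S0 u r d : R) (eta : R -> R)
    (hN : (1 <= N)%N) (hS0 : 0 < S0) (hur : r < u) (hrd : d < r) (hd : 0 < d) :
  let p := (r - d) / (u - d) in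
  let etaSN : random_variable R N := fun xi => eta (price S0 u d xi N) in
  let v := (r ^+ N)^-1 *
    \sum_(m < N.+1) 'C(N, m)%:R * p ^+ m * (1 - p) ^+ (N - m)
                    * eta (u ^+ m * d ^+ (N - m) * S0) in
  upper_expectation S0 u d r etaSN = v%:E /\
  lower_expectation S0 u d r etaSN = v%:E.
Proof.
move=> p etaSN v.
have hrep := delta_hedge_replicates R S0 u d r eta hS0 hur hrd hd N.
split.
- exact: upper_expectation_replicable hrep.
- exact: lower_expectation_replicable hrep.
Qed.
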